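(* In the setting described in the context, for any integer $M^\star$ with $1\le M^\star\le N$ there is an algorithm that computes the approximations $\widehat\phi^{(M^\star)}_{z_i}$ for all $z_i\in D$ with total running time $O(WK^2NM^\star)$.
   Context: Training set $D=\{z_1,\dots,z_N\}$, $z_i=(x_i,y_i)$ with binary labels, validation point $z^{(\mathrm{val})}=(x^{(\mathrm{val})},y^{(\mathrm{val})})$, points indexed so that $d(x_1,x^{(\mathrm{val})})\le\cdots\le d(x_N,x^{(\mathrm{val})})$; integer $K\ge2$, $N\ge K$. Weights $w_j$ lie in the set $\mathbf W$ of $2^b$ equally spaced points of $[0,1]$, $W=2^b$. Signed weights $\widetilde w_j=w_j$ if $y_j=y^{(\mathrm{val})}$, $-w_j$ otherwise. For $S\subseteq D$, $\alpha(S,j)$ is the $j$-th smallest index in $S$. $\mathrm{Cond}_{KNN}$ for $S\subseteq D\setminus\{z_i\}$: $|\{z_j\in S:j<i\}|\le K-1$. $F_i[m,\ell,s]$ ($m\in[N]$, $1\le\ell\le N-1$, $s\in\mathbb R$): number of $S\subseteq D\setminus\{z_i\}$ with $|S|=\ell$, $\mathrm{Cond}_{KNN}$, $\alpha(S,\min(\ell,K))=m$, $\sum_{j=1}^{\min(\ell,K-1)}\widetilde w_{\alpha(S,j)}=s$. $R_{i,m}=\sum_{t=1}^{m-1}\sum_{s\in[-\widetilde w_i,-\widetilde w_m)}F_i[t,K-1,s]$ if $y_i=y^{(\mathrm{val})}$, and $\sum_{t=1}^{m-1}\sum_{s\in[-\widetilde w_m,-\widetilde w_i)}F_i[t,K-1,s]$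 otherwise. $\widetilde G^{(M^\star)}_{i,0}=\mathbb 1[\widetilde w_i<0]$, and for $1\le\ell\le K-1$, $\widetilde G^{(M^\star)}_{i,\ell}=\sum_{m=1}^{M^\star}\sum_{s\in[-\widetilde w_i,0)}F_i[m,\ell,s]$ if $y_i=y^{(\mathrm{val})}$ and $\sum_{m=1}^{M^\star}\sum_{s\in[0,-\widetilde w_i)}F_i[m,\ell,s]$ otherwise. The approximation is $$\widehat\phi^{(M^\star)}_{z_i}=\big(2\mathbb 1[y_i=y^{(\mathrm{val})}]-1\big)\Big[\frac1N\sum_{\ell=0}^{K-1}\frac{\widetilde G^{(M^\star)}_{i,\ell}}{\binom{N-1}{\ell}}+\sum_{m=\max(i+1,K+1)}^{M^\star}\frac{R_{i,m}}{m\binom{m-1}{K}}\Big].$$ *)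

(* Defs.v *)
From HB Require Import structures.
From mathcomp Require Import all_boot all_order all_algebra.
From mathcomp Require Import boolp classical_sets fsbigop set_interval reals.

Set Implicit Arguments.
Unset Strict Implicit.
Unset Printing Implicit Defensive.

Import Order.TTheory GRing.Theory Num.Theory.
Local Open Scope classical_set_scope.
Local Open Scope ring_scope.

(** * Weighted KNN quantities

    Training points are the elements of ['I_N]; the point [j] is the one the
    mathematics numbers [rank j], so that ranks run over 1..N. *)

Definition rank (N : nat) (j : 'I_N) : nat := j.+1.

(* For b = 0 the quotient is 0 / 0 = 0 and the grid is the single point 0. *)
Definition weight_grid (R : realType) (b : nat) : set R :=
  [set k%:R / (2 ^ b - 1)%:R | k in [set k : nat | (k < 2 ^ b)%N]].

Definition signed_weight (R : realType) (N : nat)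
    (y : 'I_N -> bool) (yval : bool) (w : 'I_N -> R) (j : 'I_N) : R :=
  if y j == yval then w j else - w j.

(* [enum S] lists [S] in increasing order; [j] counts from 1. *)
Definition alpha (N : nat) (S : {set 'I_N}) (j : nat) : option 'I_N :=
  onth (enum S) j.-1.

Definition cond_KNN (N K : nat) (i : 'I_N) (S : {set 'I_N}) : bool :=
  (#|[set j in S | (rank j < rank i)%N]%SET| <= K - 1)%N.

(* In [F], [G_approx], [R_term], the function [sw] is the signed weight.  When
   [#|S| = l] every [alpha S j] occurring in the sum is a [Some]. *)
Definition F (R : realType) (N K : nat) (sw : 'I_N -> R)
    (i m : 'I_N) (l : nat) (s : R) : nat :=
  #|[set S : {set 'I_N} |
      [&& i \notin S, #|S| == l, cond_KNN K i S,
          alpha S (minn l K) == Some m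
        & \sum_(1 <= j < (minn l (K - 1)).+1) oapp sw 0 (alpha S j) == s]]%SET|.

(* [same] says whether the label of [i] is the validation label.  The sums over
   [s] range over real intervals and have finite support. *)
Definition R_term (R : realType) (N K : nat) (sw : 'I_N -> R)
    (same : bool) (i m : 'I_N) : R :=
  \sum_(t < N | (rank t <= rank m - 1)%N)
    if same
    then \sum_(s \in `[- sw i, - sw m[) ((F K sw i t (K - 1) s)%:R : R)
    else \sum_(s \in `[- sw m, - sw i[) ((F K sw i t (K - 1) s)%:R : R).

Definition G_approx (R : realType) (N K Mstar : nat) (sw : 'I_N -> R)
    (same : bool) (i : 'I_N) (l : nat) : R :=
  if l == 0%N then (sw i < 0)%R%:R else
  \sum_(m < N | (rank m <= Mstar)%N)
    if same
    then \sum_(s \in `[- sw i, 0[) ((F K sw i m l s)%:R : R)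
    else \sum_(s \in `[0, - sw i[) ((F K sw i m l s)%:R : R).

Definition phi_hat (R : realType) (N K Mstar : nat)
    (y : 'I_N -> bool) (yval : bool) (w : 'I_N -> R) (i : 'I_N) : R :=
  let sw := signed_weight y yval w in
  let same := y i == yval in
  (2 * same%:R - 1) *
  (N%:R^-1 * (\sum_(0 <= l < K)
                 G_approx K Mstar sw same i l / 'C(N - 1, l)%:R)
   + \sum_(m < N | (maxn (rank i).+1 K.+1 <= rank m <= Mstar)%N)
        R_term K sw same i m / (rank m * 'C(rank m - 1, K))%:R).

(** * Random access machine with unit-cost arithmetic

    A store consists of arrays of natural numbers (indices) and arrays of reals
    (values).  Programs are finite and do not depend on the real field; their
    only constants are natural numbers.  Indices support addition and truncated
    subtraction, values the field operations; both can be compared.  There is no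
    rounding of a value to an index, no index multiplication or division, and no
    bitwise operation. *)

Inductive iexp :=
| IConst of nat
| ILoad of nat & iexp
| IAdd of iexp & iexp
| ISub of iexp & iexp.

Inductive vexp :=
| VOfIdx of iexp
| VLoad of nat & iexp
| VAdd of vexp & vexp
| VSub of vexp & vexp
| VMul of vexp & vexp
| VDiv of vexp & vexp.

Inductive bexp :=
| BILe of iexp & iexp
| BVLe of vexp & vexp
| BNot of bexp
| BAnd of bexp & bexp.

(* [IStore a e1 e2] is the assignment a[e1] := e2, and likewise [VStore]. *)
Inductive cmd :=
| Skip
| IStore of nat & iexp & iexp
| VStore of nat & iexp & vexp
| Seq of cmd & cmd
| If of bexp & cmd & cmd
| While of bexp & cmd.

Record store (R : realType) := Store {
  imem : nat -> nat -> nat;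
  vmem : nat -> nat -> R
}.

Definition upd (T : Type) (f : nat -> nat -> T) (a k : nat) (v : T) :
    nat -> nat -> T :=
  fun a' k' => if (a' == a) && (k' == k) then v else f a' k'.

Fixpoint ieval (R : realType) (st : store R) (e : iexp) : nat :=
  match e with
  | IConst n => n
  | ILoad a e1 => imem st a (ieval st e1)
  | IAdd e1 e2 => (ieval st e1 + ieval st e2)%N
  | ISub e1 e2 => (ieval st e1 - ieval st e2)%N
  end.

Fixpoint veval (R : realType) (st : store R) (e : vexp) : R :=
  match e with
  | VOfIdx e1 => (ieval st e1)%:R
  | VLoad a e1 => vmem st a (ieval st e1)
  | VAdd e1 e2 => veval st e1 + veval st e2
  | VSub e1 e2 => veval st e1 - veval st e2
  | VMul e1 e2 => veval st e1 * veval st e2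
  | VDiv e1 e2 => veval st e1 / veval st e2
  end.

Fixpoint beval (R : realType) (st : store R) (e : bexp) : bool :=
  match e with
  | BILe e1 e2 => (ieval st e1 <= ieval st e2)%N
  | BVLe e1 e2 => veval st e1 <= veval st e2
  | BNot e1 => ~~ beval st e1
  | BAnd e1 e2 => beval st e1 && beval st e2
  end.

(* Evaluating an expression costs one time unit per node. *)
Fixpoint icost (e : iexp) : nat :=
  match e with
  | IConst _ => 1
  | ILoad _ e1 => (icost e1).+1
  | IAdd e1 e2 | ISub e1 e2 => (icost e1 + icost e2).+1
  end.

Fixpoint vcost (e : vexp) : nat :=
  match e with
  | VOfIdx e1 | VLoad _ e1 => (icost e1).+1
  | VAdd e1 e2 | VSub e1 e2 | VMul e1 e2 | VDiv e1 e2 =>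
      (vcost e1 + vcost e2).+1
  end.

Fixpoint bcost (e : bexp) : nat :=
  match e with
  | BILe e1 e2 => (icost e1 + icost e2).+1
  | BVLe e1 e2 => (vcost e1 + vcost e2).+1
  | BNot e1 => (bcost e1).+1
  | BAnd e1 e2 => (bcost e1 + bcost e2).+1
  end.

(* [exec c st t st']: started in [st], the program [c] halts in [st'] after
   running for time [t]. *)
Inductive exec (R : realType) : cmd -> store R -> nat -> store R -> Prop :=
| exec_skip st : exec Skip st 1 st
| exec_istore a e1 e2 st :
    exec (IStore a e1 e2) st (icost e1 + icost e2).+1
      (Store (upd (imem st) a (ieval st e1) (ieval st e2)) (vmem st))
| exec_vstore a e1 e2 st :
    exec (VStore a e1 e2) st (icost e1 + vcost e2).+1
      (Store (imem st) (upd (vmem st) a (ieval st e1) (veval st e2)))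
| exec_seq c1 c2 st1 st2 st3 t1 t2 :
    exec c1 st1 t1 st2 -> exec c2 st2 t2 st3 ->
    exec (Seq c1 c2) st1 (t1 + t2)%N st3
| exec_if e c1 c2 st st' t :
    exec (if beval st e then c1 else c2) st t st' ->
    exec (If e c1 c2) st (bcost e + t).+1 st'
| exec_while_false e c st :
    ~~ beval st e -> exec (While e c) st (bcost e).+1 st
| exec_while_true e c st1 st2 st3 t1 t2 :
    beval st1 e -> exec c st1 t1 st2 -> exec (While e c) st2 t2 st3 ->
    exec (While e c) st1 (bcost e + t1 + t2).+1 st3.

(* Index array 0 holds N, K, W, Mstar and the validation label, index array 1
   the training labels, value array 0 the (unsigned) weights; array cells are
   numbered from 0 and every other cell contains 0. *)
Definition input_store (R : realType) (N K W Mstar : nat)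
    (y : 'I_N -> bool) (yval : bool) (w : 'I_N -> R) : store R :=
  Store
    (fun a => nth 0%N (nth [::] [:: [:: N; K; W; Mstar; nat_of_bool yval];
                                    [seq nat_of_bool (y j) | j <- enum 'I_N]] a))
    (fun a => nth 0 (nth [::] [:: [seq w j | j <- enum 'I_N]] a)).

Definition output (R : realType) (N : nat) (st : store R) (i : 'I_N) : R :=
  vmem st 1 i.

(* Main.v *)
Require Import Defs.
From HB Require Import structures.
From mathcomp Require Import all_boot all_order all_algebra.
From mathcomp Require Import boolp classical_sets fsbigop set_interval reals.
From mathcomp Require Import zify ring.

(** For [l < K], [F_i] counts the [l]-subsets of the points other than [i] with a
    given maximum and a given sum of signed weights, so [R_{i,m}] and [G_{i,l}]
    count the subsets of a prefix that have a prescribed size and a weight sum in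
    a window of width O(1).  Writing the signed weight of [j] as [v_j * delta]
    with an integer [v_j], give [j] the code [A + v_j] where [A = 2 K W].  A sum
    of codes close to [l * A] can only come from a set of size [l], whose weight
    sum it then determines, and every window becomes an interval of at most [2 W]
    codes below [K A = 2 K^2 W].  For each [i] a one-dimensional subset-sum table
    over the codes is updated in place for the successive points, at cost
    O(K^2 W) per point; the windows are read off on the way. *)

Set Implicit Arguments.
Unset Strict Implicit.
Unset Printing Implicit Defensive.

Import Order.TTheory GRing.Theory Num.Theory.
Local Open Scope ring_scope.

(** * Counting subsets *)

(** Only the finitely many values of [f] have nonempty fibres, so the sum over reals reduces to one
    over the image of [f]; after exchanging sums each admissible [S] is counted once, at
    [s = f S]. *)
Lemma fsum_card_fiber (R : realType) (T : finType) (P : pred T) (f : T -> R)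
    (D : {pred R}) :
  \sum_(s \in [set` D]) (#|[set S | P S && (f S == s)]%SET|%:R : R) =
  #|[set S | P S && (f S \in D)]%SET|%:R.
Proof.
rewrite -(bigfs _ (undup_uniq (codom f))); last first.
  move=> s _; rewrite mem_undup => sf; rewrite eq_card0 // => S.
  rewrite !inE; apply/negP => /andP[_ /eqP fS]; move/negP: sf; apply.
  by rewrite -fS codom_f.
rewrite -natr_sum; congr (_%:R).
under eq_bigr do rewrite -sum1_card big_mkcond.
rewrite exchange_big /= -sum1_card [RHS]big_mkcond; apply: eq_bigr => S _.
rewrite inE; have [DS|DS] := boolP (f S \in D); last first.
  rewrite andbF big1 // => s Ds; rewrite inE.
  by case: eqP => [fs|]; rewrite ?andbF //; rewrite fs unfold_in Ds in DS.
rewrite big_mkcond (bigD1_seq (f S)) ?undup_uniq ?mem_undup ?codom_f //=.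
rewrite (DS : D (f S)) inE eqxx andbT big1 ?addn0 // => s /negPf sf.
by rewrite inE eq_sym sf andbF if_same.
Qed.

(** The bound [m] is a number of points: for a point [m] these are the points strictly before it,
    without [i]. *)
Definition prefix_set (N : nat) (i : 'I_N) (m : nat) : {set 'I_N} :=
  [set j : 'I_N | (j < m)%N && (j != i)]%SET.

Lemma sorted_enum_ord (N : nat) (S : {set 'I_N}) :
  sorted ltn [seq val j | j <- enum S].
Proof.
rewrite sorted_map /enum_mem -enumT.
apply: sorted_filter => [x y z|]; first exact: ltn_trans.
by have := iota_ltn_sorted 0 N; rewrite -val_enum_ord sorted_map.
Qed.

(** The last entry of the increasing enumeration is the maximum of [S]. *)
Lemma alpha_last (N : nat) (S : {set 'I_N}) (t : 'I_N) (l : nat) :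
  #|S| = l -> (0 < l)%N ->
  (alpha S l == Some t) = (t \in S) && [forall j in S, (j <= t)%N].
Proof.
move=> Sl l0; rewrite /alpha; have sS := sorted_enum_ord S.
have szS : size (enum S) = l by rewrite -cardE.
have lt1 : (l.-1 < size (enum S))%N by rewrite szS prednK.
have -> : onth (enum S) l.-1 = Some (nth t (enum S) l.-1).
  by rewrite onthE (nth_map t).
rewrite (inj_eq Some_inj); apply/eqP/andP => [<-|[tS /'forall_implyP St]].
  split; first by rewrite -mem_enum mem_nth.
  apply/'forall_implyP => j; rewrite -mem_enum => jS.
  have jl := jS; rewrite -index_mem in jl.
  rewrite -[X in (val X <= _)%N](nth_index t jS).
  rewrite -!(nth_map t 0%N val) //.
  apply: (sorted_leq_nth leq_trans leqnn); rewrite ?inE ?size_map //.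
    by apply: sub_sorted sS; exact: ltnW.
  by rewrite -ltnS prednK // -szS.
apply/val_inj/eqP; rewrite eqn_leq St /=; last by rewrite -mem_enum mem_nth.
rewrite -mem_enum in tS; have tl := tS; rewrite -index_mem in tl.
rewrite -[X in (X <= _)%N](congr1 val (nth_index t tS)).
rewrite -!(nth_map t 0%N val) //.
apply: (sorted_leq_nth leq_trans leqnn); rewrite ?inE ?size_map //.
  by apply: sub_sorted sS; exact: ltnW.
by rewrite -ltnS prednK // -szS.
Qed.

Lemma alpha_sum (R : realType) (N : nat) (sw : 'I_N -> R) (S : {set 'I_N}) :
  \sum_(1 <= j < #|S|.+1) oapp sw 0 (alpha S j) = \sum_(j in S) sw j.
Proof.
have [->|[j0 j0S]] := set_0Vmem S; first by rewrite cards0 big_set0 big_geq.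
rewrite big_add1 -big_enum /= (big_nth j0) cardE; apply: eq_big_nat => k /= kS.
by rewrite /alpha /= onthE (nth_map j0).
Qed.

(** For [l < K] both minima in [F] are at most [l] and [cond_KNN] follows from [#|S| = l], so [F]
    fixes the size, the maximum [t] and the weight sum. Summing over [t < m] leaves the condition
    that [S] lies in the prefix. *)
Lemma sum_F (R : realType) (N K : nat) (sw : 'I_N -> R) (i : 'I_N) (l m : nat)
    (D : {pred R}) :
  (0 < l < K)%N ->
  \sum_(t < N | (t < m)%N) \sum_(s \in [set` D]) ((F K sw i t l s)%:R : R) =
  #|[set S : {set 'I_N} | [&& S \subset prefix_set i m, #|S| == l
       & \sum_(j in S) sw j \in D]]%SET|%:R.
Proof.
move=> /andP[l0 lK].
pose P (t : 'I_N) (S : {set 'I_N}) :=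
  [&& i \notin S, #|S| == l & alpha S l == Some t].
have FE t s : F K sw i t l s =
    #|[set S | P t S && (\sum_(j in S) sw j == s)]%SET|.
  apply: eq_card => S; rewrite !inE /P.
  have -> : minn l K = l by lia.
  have -> : minn l (K - 1) = l by lia.
  case: eqP => [Sl|]; rewrite ?andbF //= -{2}Sl alpha_sum.
  suff -> : cond_KNN K i S by rewrite /= !andbA.
  rewrite /cond_KNN; apply: (@leq_trans #|S|); last by rewrite Sl; lia.
  by apply: subset_leq_card; apply/fintype.subsetP => j; rewrite inE => /andP[].
under eq_bigr => t _ do (under eq_fsbigr => s _ do rewrite FE);
  under eq_bigr => t _ do rewrite fsum_card_fiber.
rewrite -natr_sum; congr (_%:R).
under eq_bigr do rewrite -sum1_card big_mkcond.
rewrite exchange_big /= -sum1_card [RHS]big_mkcond; apply: eq_bigr => S _.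
rewrite inE; have [DS|DS] := boolP (\sum_(j in S) sw j \in D); last first.
  by rewrite !andbF big1 // => t _; rewrite inE (negPf DS) andbF.
rewrite andbT; have [/eqP Sl|Sl] := boolP (#|S| == l); last first.
  by rewrite andbF big1 // => t _; rewrite inE /P (negPf Sl) andbF.
(* As [l] is positive, [S] has a largest element [t1], the only [t] for which [P t S] can hold. *)
have [t0 t0S] : exists t, t \in S by apply/card_gt0P; rewrite Sl.
pose t1 := [arg max_(t > t0 in S) (t : nat)].
have [t1S St1] : t1 \in S /\ forall j, j \in S -> (j <= t1)%N.
  by rewrite /t1; case: arg_maxnP.
have PE t : P t S = (i \notin S) && (t == t1).
  rewrite /P Sl eqxx /= (alpha_last t Sl l0); congr (_ && _).
  apply/andP/eqP => [[tS /'forall_implyP St]|->].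
    by apply/val_inj/eqP; rewrite eqn_leq St ?St1.
  by split=> //; apply/'forall_implyP.
transitivity (if (i \notin S) && (t1 < m)%N then 1 else 0)%N.
  case: ifP => [/andP[iS t1m]|/negP h].
    rewrite (bigD1 t1) //= inE PE iS eqxx DS big1 ?addn0 // => t /andP[_ tt1].
    by rewrite inE PE (negPf tt1) andbF.
  rewrite big1 // => t tm; rewrite inE PE; case: ifP => // /andP[/andP[iS /eqP tt1] _].
  by case: h; rewrite iS -tt1.
rewrite andbT; congr (if _ then _ else _).
apply/andP/fintype.subsetP => [[iS t1m] j jS|h].
  rewrite inE (leq_ltn_trans (St1 _ jS)) //=.
  by apply: contraNneq iS => <-.
split; last by have := h _ t1S; rewrite inE => /andP[].
by apply/negP => /h; rewrite inE eqxx andbF.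
Qed.

(** The 0-1 knapsack recurrence for counting; it has no size parameter, because the codes will
    encode the size. *)
Fixpoint subset_count (e : nat -> nat) (i m x : nat) : nat :=
  if m is m'.+1 then
    (subset_count e i m' x +
     if (m' != i) && (e m' <= x) then subset_count e i m' (x - e m') else 0)%N
  else (x == 0)%N.

Lemma prefix_setS (N : nat) (i m : 'I_N) :
  prefix_set i m.+1 = (if m != i then m |: prefix_set i m else prefix_set i m)%SET.
Proof.
apply/setP => j; rewrite inE ltnS leq_eqVlt.
have [->|jm] := eqVneq j m; first by rewrite eqxx; case: ifP; rewrite !inE ?eqxx ?ltnn.
by rewrite (inj_eq val_inj) (negPf jm); case: ifP; rewrite !inE ?(negPf jm).
Qed.

(** Induction on the prefix, splitting the sets by whether they contain the newest point. *)
Lemma subset_countE (N : nat) (e : nat -> nat) (i : 'I_N) (m x : nat) :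
  (m <= N)%N ->
  subset_count e i m x =
  #|[set S : {set 'I_N} | (S \subset prefix_set i m)
       && (\sum_(j in S) e j == x)%N]%SET|.
Proof.
elim: m x => [|m IHm] x mN /=.
  have -> : prefix_set i 0 = finset.set0 by apply/setP => j; rewrite !inE.
  have -> : [set S : {set 'I_N} | (S \subset finset.set0) && (\sum_(j in S) e j == x)%N]%SET
      = (if x == 0%N then [set finset.set0] else finset.set0)%SET.
    apply/setP => S; rewrite inE finset.subset0.
    have [->|S0] := eqVneq S finset.set0.
      by rewrite big_set0 eq_sym; case: ifP; rewrite !inE ?eqxx.
    by case: ifP; rewrite !inE ?(negPf S0).
  by case: ifP; rewrite ?cards1 ?cards0.
pose mo := Ordinal mN; rewrite !IHm ?(ltnW mN) //.
rewrite -[m in prefix_set i m.+1]/(val mo) (prefix_setS i mo).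
have mim : mo \notin prefix_set i m by rewrite inE ltnn.
have -> : (m != i) = (mo != i) by [].
case: (eqVneq mo i) => [_|mi] /=; first by rewrite addn0.
rewrite -[RHS](cardsID [set S : {set 'I_N} | mo \in S]%SET) addnC /=; congr (_ + _)%N.
  case: leqP => [ex|xe].
    (* Adjoining [mo] is injective on the subsets of the old prefix and yields exactly the new sets
       containing [mo]. *)
    rewrite -(card_in_imset (f := fun S => mo |: S)%SET); last first.
      move=> S T; rewrite !inE => /andP[/fintype.subsetP Sm _] /andP[/fintype.subsetP Tm _] ST.
      have mS : mo \notin S by apply: contra mim; exact: Sm.
      have mT : mo \notin T by apply: contra mim; exact: Tm.
      by rewrite -(finset.setU1K mS) ST finset.setU1K.
    apply: eq_card => T; rewrite !inE; apply/imsetP/andP.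
      move=> [S]; rewrite inE => /andP[Sm /eqP Sx] ->; rewrite finset.setU11 finset.setUS //=.
      have mS : mo \notin S by apply: contra mim; move/fintype.subsetP: Sm; exact.
      by rewrite big_setU1 //= Sx subnKC.
    move=> [/andP[Tm /eqP Tx] mT]; exists (T :\ mo)%SET; last by rewrite finset.setD1K.
    rewrite inE finset.subDset Tm; move: Tx; rewrite (big_setD1 mo) //= => <-.
    by rewrite addKn.
  apply/esym/eqP; rewrite cards_eq0; apply/eqP/setP => S; rewrite !inE.
  apply/negP => /andP[/andP[_ /eqP Sx] mS]; move: Sx.
  by rewrite (big_setD1 mo) //=; lia.
apply: eq_card => S; rewrite !inE.
have [mS|mS] := boolP (mo \in S).
  by apply/negbTE; rewrite negb_and; apply/orP; left; apply: contra mim => /fintype.subsetP; exact.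
rewrite /=; congr (_ && _); apply/fintype.subsetP/fintype.subsetP => h j jS.
  by rewrite inE h ?orbT.
by have := h j jS; rewrite 2!inE; case: eqP => // jm; rewrite -jm jS in mS.
Qed.

Lemma sum_subset_count (N : nat) (e : nat -> nat) (i : 'I_N) (m lo hi : nat) :
  (m <= N)%N ->
  (\sum_(lo <= x < hi) subset_count e i m x)%N =
  #|[set S : {set 'I_N} | (S \subset prefix_set i m)
       && (lo <= \sum_(j in S) e j < hi)%N]%SET|.
Proof.
move=> mN; under eq_bigr do rewrite subset_countE // -sum1_card big_mkcond.
rewrite exchange_big /= -sum1_card [RHS]big_mkcond; apply: eq_bigr => S _.
rewrite inE; case: ifP => [/andP[Sm Se]|/negP h].
  rewrite (bigD1_seq (\sum_(j in S) e j)%N) ?iota_uniq ?mem_index_iota //=.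
  rewrite inE Sm eqxx big1 ?addn0 // => x /negPf xS.
  by rewrite inE eq_sym xS andbF.
rewrite big_nat big1 // => x xlh; rewrite inE; case: ifP => // /andP[Sm /eqP Sx].
by case: h; rewrite Sm Sx.
Qed.

(** The label decides which end comes first, as in [R_term] and [G_approx]; ends in the wrong order
    give an empty sum. *)
Definition window_sum (same : bool) (c : nat -> nat) (p q : nat) : nat :=
  if same then (\sum_(p <= x < q) c x)%N else (\sum_(q <= x < p) c x)%N.

Definition window (R : realType) (same : bool) (a b : R) : interval R :=
  if same then `[a, b[ else `[b, a[.

(** * Weight windows as intervals of codes *)

Section Codes.
Variables (R : realType) (N K W : nat) (e : nat -> nat) (sw : 'I_N -> R).
Variable (delta : R).
Let A := (2 * K * W)%N.
Hypothesis (W_gt0 : (0 < W)%N) (K_gt1 : (2 <= K)%N) (delta_gt0 : 0 < delta).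
Hypothesis e_bounds : forall j : 'I_N, (A - W <= e j <= A + W)%N.
Hypothesis swE : forall j : 'I_N, sw j = ((e j)%:R - A%:R) * delta.

Lemma code_bounds (S : {set 'I_N}) :
  (#|S| * (A - W) <= \sum_(j in S) e j <= #|S| * (A + W))%N.
Proof.
rewrite -!sum_nat_const; apply/andP; split; apply: leq_sum => j _;
  by have /andP[] := e_bounds j.
Qed.

(* Near [l * A] only the codes of sets of size [l] occur, because the deviations
   of at most [K] items from [A] add up to at most [K * W = A / 2]. *)
Lemma code_size (S : {set 'I_N}) (l : nat) : (l < K)%N ->
  (l * A - W <= \sum_(j in S) e j <= l * A + W)%N -> #|S| = l.
Proof.
move=> lK; have := code_bounds S; move: (\sum_(j in S) e j)%N => x.
move: #|S| => n /andP[nx xn] /andP[lx xl].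
have [nl|ln|//] := ltngtP n l; exfalso.
  have : (n * (A + W) <= l.-1 * (A + W))%N by rewrite leq_mul2r; lia.
  have : (l.-1 * (A + W) = l.-1 * A + l.-1 * W)%N by rewrite mulnDr.
  have : (l.-1 * W <= K * W)%N by rewrite leq_mul2r; lia.
  have : (l * A = l.-1 * A + A)%N by rewrite -{1}(@prednK l) ?mulSn; lia.
  have : (2 * W <= K * W)%N by rewrite leq_mul2r K_gt1 orbT.
  have : A = (K * W + K * W)%N by rewrite /A; lia.
  lia.
have : (l.+1 * (A - W) <= n * (A - W))%N by rewrite leq_mul2r ln orbT.
have : (l.+1 * (A - W) = l.+1 * A - l.+1 * W)%N by rewrite mulnBr.
have : (l.+1 * W <= K * W)%N by rewrite leq_mul2r lK orbT.
have : (2 * W <= K * W)%N by rewrite leq_mul2r K_gt1 orbT.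
have : A = (K * W + K * W)%N by rewrite /A; lia.
have : (l.+1 * A = A + l * A)%N by rewrite mulSn.
lia.
Qed.

Lemma sum_sw (S : {set 'I_N}) :
  \sum_(j in S) sw j = ((\sum_(j in S) e j)%:R - (#|S| * A)%:R) * delta.
Proof.
rewrite (eq_bigr _ (fun j _ => swE j)).
by rewrite -mulr_suml sumrB natr_sum sumr_const natrM mulr_natl.
Qed.

(** A weight bound [-(p - A) delta] on a set of size [l] is the bound
    [l A - (p - A) = (l + 1) A - p] on its code sum. Since [p] and [q] are within [W] of [A], the
    window stays within [W] of [l A], and [code_size] recovers the size. *)
Lemma window_sumE (same : bool) (i : 'I_N) (m l p q : nat) : (m <= N)%N ->
  (l < K)%N -> (A - W <= p <= A + W)%N -> (A - W <= q <= A + W)%N ->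
  window_sum same (subset_count e i m) (l.+1 * A - p) (l.+1 * A - q) =
  #|[set S : {set 'I_N} | [&& S \subset prefix_set i m, #|S| == l
       & \sum_(j in S) sw j \in
         window same (- ((p%:R - A%:R) * delta)) (- ((q%:R - A%:R) * delta))]]%SET|.
Proof.
(* The case [same = false] is the case [same = true] with [p] and [q] exchanged. *)
move=> mN lK; wlog -> : same p q / same = true.
  move=> th; case: same; first exact: th.
  by move=> pA qA; have := th true q p erefl qA pA.
move=> pA qA; rewrite /window_sum /window sum_subset_count //.
apply: eq_card => S; rewrite [LHS]inE [RHS]inE; congr (_ && _).
have lA : (l.+1 * A = A + l * A)%N by rewrite mulSn.
have swl : #|S| = l -> (\sum_(j in S) sw j \in
    `[- ((p%:R - A%:R) * delta), - ((q%:R - A%:R) * delta)[) =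
    (l.+1 * A - p <= \sum_(j in S) e j < l.+1 * A - q)%N.
  move=> Sl; rewrite sum_sw Sl in_itv /=; move: (\sum_(j in S) e j)%N => x.
  rewrite leq_subLR ltn_subRL lA.
  rewrite -subr_ge0 -[X in _ && X]subr_gt0.
  have -> : (x%:R - (l * A)%:R) * delta - - ((p%:R - A%:R) * delta) =
      ((p + x)%:R - (A + l * A)%:R) * delta by rewrite !natrD; ring.
  have -> : - ((q%:R - A%:R) * delta) - (x%:R - (l * A)%:R) * delta =
      ((A + l * A)%:R - (q + x)%:R) * delta by rewrite !natrD; ring.
  by rewrite pmulr_lge0 // pmulr_lgt0 // subr_ge0 subr_gt0 ler_nat ltr_nat.
apply/idP/andP => [Sx|[/eqP Sl]]; last by rewrite swl.
have Sl : #|S| = l by apply: code_size => //; lia.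
by rewrite swl // Sl eqxx.
Qed.

(** Here [l = K - 1], so [l.+1 * A] is [K * A], and the table needed is the one over the points
    before [m]. *)
Lemma R_termE (same : bool) (i m : 'I_N) :
  R_term K sw same i m =
  (window_sum same (subset_count e i m) (K * A - e i) (K * A - e m))%:R.
Proof.
have K0 : (0 < K - 1 < K)%N by lia.
have KE : K = (K - 1).+1 by lia.
rewrite {2 3}KE window_sumE ?e_bounds -?swE ?(ltnW (ltn_ord m)) //; last by lia.
rewrite /R_term; under eq_bigl do rewrite /rank subn1 /=.
by rewrite /window; case: same => /=; rewrite sum_F.
Qed.

(** The endpoint 0 has code [A]. The sign condition serves [l = 0]: under it, the window contains 0,
    the sum of the empty set, exactly when [sw i < 0]. *)
Lemma G_approxE (same : bool) (i : 'I_N) (M l : nat) : (M <= N)%N ->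
  (l < K)%N -> (if same then 0 <= sw i else sw i <= 0) ->
  G_approx K M sw same i l =
  (window_sum same (subset_count e i M) (l.+1 * A - e i) (l * A))%:R.
Proof.
move=> MN lK sgn.
have -> : (l * A = l.+1 * A - A)%N by rewrite mulSn addKn.
rewrite window_sumE ?e_bounds -?swE ?subrr ?mul0r ?oppr0 //; last by lia.
rewrite /G_approx; case: eqP => [->|/eqP l0]; last first.
  rewrite /window; under eq_bigl do rewrite /rank.
  by case: same sgn => /= _; rewrite sum_F //; lia.
have -> : [set S : {set 'I_N} | [&& S \subset prefix_set i M, #|S| == 0%N
     & \sum_(j in S) sw j \in window same (- sw i) 0]]%SET =
    (if sw i < 0 then [set finset.set0] else finset.set0)%SET.
  apply/setP => S; rewrite [LHS]inE cards_eq0.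
  have [->|S0] := eqVneq S finset.set0; last first.
    by rewrite andbF; case: ifP; rewrite !inE ?(negPf S0).
  rewrite finset.sub0set big_set0 /window /=.
  case: same sgn => /= sgn; rewrite in_itv /= ?ltxx ?lexx ?andbF /=.
    by rewrite ltNge sgn inE.
  by rewrite oppr_gt0; case: ifP; rewrite !inE ?eqxx.
by case: ifP; rewrite ?cards1 ?cards0.
Qed.

End Codes.

(** Recovers the numerator of a grid weight by [W] comparisons, since the machine cannot round a
    value to an index. *)
Definition grid_index (R : realType) (W : nat) (v : R) : nat :=
  (\sum_(0 <= k < W) ~~ (v * (W - 1)%:R <= k%:R)%R)%N.

Definition item_code (same : bool) (A k : nat) : nat :=
  if same then (A + k)%N else (A - k)%N.

Lemma sum_ltn (n k : nat) : (\sum_(0 <= r < n) (r < k))%N = minn n k.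
Proof.
elim: n => [|n IHn]; first by rewrite big_geq ?min0n.
by rewrite big_nat_recr //= IHn; lia.
Qed.

(* The choice [delta = 1] covers [b = 0], where all weights vanish. *)
Lemma grid_step (R : realType) (b : nat) :
  exists2 delta : R, 0 < delta & forall v, weight_grid b v ->
    (grid_index (2 ^ b) v < 2 ^ b)%N /\ v = (grid_index (2 ^ b) v)%:R * delta.
Proof.
have b0 : (0 < 2 ^ b)%N by rewrite expn_gt0.
have [b1|b1] := eqVneq (2 ^ b - 1)%N 0%N.
  exists 1 => // v [k _ <-]; rewrite /grid_index b1 invr0 !mulr0 mulr1.
  by rewrite big1 // => r _; rewrite ler0n.
have b1R : (2 ^ b - 1)%:R != 0 :> R by rewrite pnatr_eq0.
exists (2 ^ b - 1)%:R^-1; first by rewrite invr_gt0 ltr0n lt0n.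
move=> v [k /= kW <-].
suff -> : grid_index (2 ^ b) (k%:R / (2 ^ b - 1)%:R : R) = k by [].
rewrite /grid_index mulfVK //; under eq_bigr do rewrite ler_nat -ltnNge.
by rewrite sum_ltn; apply/minn_idPr/ltnW.
Qed.

(** The bracket of [phi_hat] in terms of the table: the second sum reads it after [j] points, the
    first after all [M]. *)
Definition phi_dp (R : realType) (N K M A : nat) (e : nat -> nat) (same : bool)
    (i : nat) : R :=
  (N%:R^-1 * (\sum_(0 <= l < K)
     (window_sum same (subset_count e i M) (l.+1 * A - e i) (l * A))%:R
       / 'C(N - 1, l)%:R)
   + \sum_(0 <= j < M | (i < j)%N && (K <= j)%N)
     (window_sum same (subset_count e i j) (K * A - e i) (K * A - e j))%:R
       / (j.+1 * 'C(j, K))%:R).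

Lemma phi_hatE (R : realType) (N K b M : nat) (y : 'I_N -> bool) (yval : bool)
    (w : 'I_N -> R) (e : nat -> nat) (i : 'I_N) :
  (2 <= K)%N -> (M <= N)%N ->
  (forall j : 'I_N, weight_grid b (w j)) ->
  (forall j : 'I_N, e j =
     item_code (y j == yval) (2 * K * 2 ^ b) (grid_index (2 ^ b) (w j))) ->
  phi_hat K M y yval w i =
  (2 * (y i == yval)%:R - 1) * phi_dp R N K M (2 * K * 2 ^ b) e (y i == yval) i.
Proof.
move=> K2 MN wW eE; have [delta d0 dE] := grid_step R b.
have W0 : (0 < 2 ^ b)%N by rewrite expn_gt0.
have WA : (2 ^ b <= 2 * K * 2 ^ b)%N by rewrite leq_pmull; lia.
have eb (j : 'I_N) :
    (2 * K * 2 ^ b - 2 ^ b <= e j <= 2 * K * 2 ^ b + 2 ^ b)%N.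
  have [kW _] := dE _ (wW j).
  by rewrite eE /item_code; case: ifP => _; lia.
have swE (j : 'I_N) : signed_weight y yval w j =
    ((e j)%:R - (2 * K * 2 ^ b)%:R) * delta.
  have [kW wE] := dE _ (wW j).
  rewrite /signed_weight eE /item_code [in LHS]wE; case: ifP => _.
    by rewrite natrD addrAC subrr add0r.
  by rewrite natrB ?(leq_trans (ltnW kW)) // addrAC subrr add0r mulNr.
rewrite /phi_hat /phi_dp; congr (_ * (_ * _ + _)).
  apply: eq_big_nat => l /andP[_ lK].
  rewrite (G_approxE W0 K2 d0 eb swE) // /signed_weight.
  have [_ ->] := dE _ (wW i).
  have k0 : 0 <= (grid_index (2 ^ b) (w i))%:R * delta by rewrite mulr_ge0 // ltW.
  by case: (y i == yval); rewrite ?oppr_le0.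
pose g (j : nat) := (window_sum (y i == yval) (subset_count e i j)
  (K * (2 * K * 2 ^ b) - e i) (K * (2 * K * 2 ^ b) - e j))%:R
       / (j.+1 * 'C(j, K))%:R : R.
(* In zero-based indices the ranks from [maxn (rank i).+1 K.+1] to [M] become [i < m], [K <= m] and
   [m < M]. *)
transitivity (\sum_(m < N | ((i < m)%N && (K <= m)%N) && (m < M)%N) g m).
  apply: eq_big => [m|m _]; first by rewrite /rank geq_max !ltnS.
  by rewrite (R_termE W0 K2 d0 eb swE) /rank subn1.
rewrite big_mkord; apply/esym.
exact: (big_ord_widen_cond _ (fun m => (i < m)%N && (K <= m)%N) g MN).
Qed.

(** * Running programs *)

Fixpoint csize (c : cmd) : nat :=
  match c with
  | Skip => 1
  | IStore _ e1 e2 => (icost e1 + icost e2).+1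
  | VStore _ e1 e2 => (icost e1 + vcost e2).+1
  | Seq c1 c2 => csize c1 + csize c2
  | If e c1 c2 => (bcost e + csize c1 + csize c2).+1
  | While e c1 => (bcost e + csize c1).+1
  end.

Fixpoint imods (c : cmd) : seq nat :=
  match c with
  | IStore a _ _ => [:: a]
  | Seq c1 c2 | If _ c1 c2 => imods c1 ++ imods c2
  | While _ c1 => imods c1
  | _ => [::]
  end.

Fixpoint vmods (c : cmd) : seq nat :=
  match c with
  | VStore a _ _ => [:: a]
  | Seq c1 c2 | If _ c1 c2 => vmods c1 ++ vmods c2
  | While _ c1 => vmods c1
  | _ => [::]
  end.

(** Assignments are tracked by whole arrays, so preservation of a fact reduces to membership in a
    concrete list. *)
Definition frame (R : realType) (c : cmd) (st st' : store R) : Prop :=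
  (forall a, a \notin imods c -> imem st' a =1 imem st a) /\
  (forall a, a \notin vmods c -> vmem st' a =1 vmem st a).

(* The running time is measured in multiples of the size of the program, so that
   the absolute constants never have to be computed. *)
Definition run (R : realType) (q : nat) (c : cmd) (st : store R)
    (Q : store R -> Prop) : Prop :=
  exists t st', [/\ exec c st t st', (t <= csize c * q)%N & Q st'].

(** * Proof rules for total correctness with running time *)

Section Rules.
Variable R : realType.
Implicit Types (st : store R) (Q : store R -> Prop) (c : cmd) (q : nat).

Lemma exec_frame c st t st' : exec c st t st' -> frame c st st'.
Proof.
elim=> {c st t st'} //=.
- move=> a e1 e2 st; split=> //= a'; rewrite inE /upd => /negPf na k.
  by rewrite na.
- move=> a e1 e2 st; split=> //= a'; rewrite inE /upd => /negPf na k.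
  by rewrite na.
- move=> c1 c2 st1 st2 st3 t1 t2 _ [I1 V1] _ [I2 V2].
  by split=> a /=; rewrite mem_cat negb_or => /andP[n1 n2] k;
    rewrite ?I2 ?I1 ?V2 ?V1.
- move=> e c1 c2 st st' t _ [I1 V1].
  by split=> a /=; rewrite mem_cat negb_or => /andP[n1 n2] k;
    rewrite ?I1 ?V1 //; case: ifP.
- move=> e c st1 st2 st3 t1 t2 _ _ [I1 V1] _ [I2 V2].
  by split=> a /= na k; rewrite ?I2 ?I1 ?V2 ?V1.
Qed.

Lemma run_call q q' c st Q' Q :
  run q' c st Q' -> (q' <= q)%N ->
  (forall st', frame c st st' -> Q' st' -> Q st') -> run q c st Q.
Proof.
move=> [t [st' [ex tq Qst]]] qq QQ; exists t, st'; split=> //.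
  by rewrite (leq_trans tq)// leq_mul2l qq orbT.
exact: QQ (exec_frame ex) Qst.
Qed.

Lemma run_skip q st Q : (0 < q)%N -> Q st -> run q Skip st Q.
Proof. by move=> q0 Qst; exists 1%N, st; split; rewrite ?mul1n //; exact: exec_skip. Qed.

Lemma run_istore q a e1 e2 st Q : (0 < q)%N ->
  Q (Store (upd (imem st) a (ieval st e1) (ieval st e2)) (vmem st)) ->
  run q (IStore a e1 e2) st Q.
Proof.
move=> q0 Qst; eexists _, _; split; [constructor| |exact: Qst].
exact: leq_pmulr.
Qed.

Lemma run_vstore q a e1 e2 st Q : (0 < q)%N ->
  Q (Store (imem st) (upd (vmem st) a (ieval st e1) (veval st e2))) ->
  run q (VStore a e1 e2) st Q.
Proof.
move=> q0 Qst; eexists _, _; split; [constructor| |exact: Qst].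
exact: leq_pmulr.
Qed.

(** Program sizes add up, so one factor [q] serves both commands. *)
Lemma run_seq q c1 c2 st Q :
  run q c1 st (fun st' => run q c2 st' Q) -> run q (Seq c1 c2) st Q.
Proof.
move=> [t1 [st1 [ex1 le1 [t2 [st2 [ex2 le2 Qst]]]]]].
exists (t1 + t2)%N, st2; split=> //; first exact: exec_seq ex1 ex2.
by rewrite /= mulnDl leq_add.
Qed.

Lemma run_if q e c1 c2 st Q : (0 < q)%N ->
  run q (if beval st e then c1 else c2) st Q -> run q (If e c1 c2) st Q.
Proof.
move=> q0 [t [st' [ex le Qst]]]; eexists _, st'; split; [exact: exec_if ex| |exact: Qst].
rewrite /= -!addSn -addnA mulnDl leq_add ?leq_pmulr//.
by rewrite (leq_trans le)// leq_mul2r; case: ifP; rewrite ?leq_addr ?leq_addl orbT.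
Qed.

(** Cell 0 of an array serves as a scalar register. *)
Definition reg (a : nat) : iexp := ILoad a (IConst 0).
Definition iset (a : nat) (e : iexp) : cmd := IStore a (IConst 0) e.
Definition vreg (a : nat) : vexp := VLoad a (IConst 0).
Definition vset (a : nat) (e : vexp) : cmd := VStore a (IConst 0) e.

Definition For (r : nat) (bnd : iexp) (body : cmd) : cmd :=
  Seq (iset r (IConst 0))
    (While (BNot (BILe bnd (reg r)))
       (Seq body (iset r (IAdd (reg r) (IConst 1))))).

(** The factor is [n.+1] because the failing last test is paid for as well. *)
Lemma run_while (I : nat -> store R -> Prop) q n e c st : (0 < q)%N ->
  I 0%N st ->
  (forall k st', (k <= n)%N -> I k st' -> beval st' e = (k < n)%N) ->
  (forall k st', (k < n)%N -> I k st' -> run q c st' (I k.+1)) ->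
  run (n.+1 * q) (While e c) st (I n).
Proof.
move=> q0 I0 Ib Ic.
(* Induction on the number [d] of iterations left. *)
suff run_from d k st' : (k + d = n)%N -> I k st' ->
    exists t st'', [/\ exec (While e c) st' t st'',
      (t <= d.+1 * (csize (While e c) * q))%N & I n st''].
  have [t [st' [ex le Ist]]] := run_from n 0%N st (add0n n) I0.
  by exists t, st'; split=> //; rewrite mulnCA.
elim: d k st' => [|d IHd] k st' dk Ik.
  rewrite addn0 in dk; subst k.
  exists (bcost e).+1, st'; split=> //.
    by apply: exec_while_false; rewrite (Ib n) // ltnn.
  by rewrite mul1n /=; nia.
have kn : (k < n)%N by lia.
have [t1 [st1 [ex1 le1 I1]]] := Ic k st' kn Ik.
have [||t2 [st2 [ex2 le2 I2]]] := IHd k.+1 st1 => //; first by lia.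
exists (bcost e + t1 + t2).+1, st2; split=> //.
  by apply: exec_while_true ex1 ex2; rewrite (Ib k) // ltnW.
rewrite mulSn -!addSn leq_add // (leq_trans _ (_ : (bcost e).+1 * q + csize c * q <= _)%N)//.
  by rewrite leq_add // leq_pmulr.
by rewrite /= -mulnDl addSn.
Qed.

(** The loop frame is handed to every obligation, so facts about untouched arrays stay out of [I].
    The bound is re-evaluated at each test and must therefore give [n] in every framed state. *)
Lemma run_for (I : nat -> store R -> Prop) q q' n r bnd body st Q :
  (0 < q)%N -> (n.+1 * q <= q')%N -> r \notin imods body ->
  (forall st', frame (For r bnd body) st st' -> ieval st' bnd = n) ->
  I 0%N (Store (upd (imem st) r 0 0) (vmem st)) ->
  (forall k st', (k < n)%N -> frame (For r bnd body) st st' ->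
     imem st' r 0 = k -> I k st' ->
     run q body st' (fun st'' =>
       I k.+1 (Store (upd (imem st'') r 0 k.+1) (vmem st'')))) ->
  (forall st', frame (For r bnd body) st st' -> I n st' -> Q st') ->
  run q' (For r bnd body) st Q.
Proof.
move=> q0 qq rb Hb I0 Ik IQ.
have q'0 : (0 < q')%N by apply: leq_trans qq; rewrite muln_gt0.
apply: run_seq; apply: run_istore => //=.
set st0 := Store _ _.
have fr0 : frame (For r bnd body) st st0.
  split=> a //=; rewrite inE negb_or => /andP[/negPf na _] k.
  by rewrite /upd na.
have frt st1 st2 : frame (For r bnd body) st st1 ->
    frame (Seq body (iset r (IAdd (reg r) (IConst 1)))) st1 st2 ->
    frame (For r bnd body) st st2.
  move=> [I1 V1] [I2 V2]; split=> a /= na k.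
    by rewrite I2 ?I1 //=; move: na; rewrite inE negb_or => /andP[].
  by rewrite V2 ?V1.
pose J k st' := [/\ frame (For r bnd body) st st', imem st' r 0 = k & I k st'].
apply: (@run_call _ (n.+1 * q)%N _ _ (J n)) => //; last first.
  by move=> st' _ [fr _ In]; apply: IQ.
apply: run_while => //.
- by split=> //; rewrite /= /upd !eqxx.
- by move=> k st' kn [fr rk _] /=; rewrite Hb // rk ltnNge.
move=> k st' kn [fr rk Hk].
apply: (@run_call q q _ _ (J k.+1)) => //; last first.
apply: run_seq.
have [t [st1 [ex le Hst]]] := Ik _ _ kn fr rk Hk.
exists t, st1; split=> //; apply: run_istore => //=.
have rk1 : imem st1 r 0 = k by rewrite (exec_frame ex).1.
rewrite rk1 addn1; split=> //=; last by rewrite /upd !eqxx.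
apply: (frt st') => //; split=> a /=.
  by rewrite mem_cat inE negb_or => /andP[na /negPf nr] x; rewrite /upd nr /= (exec_frame ex).1.
by rewrite cats0 => na x; rewrite (exec_frame ex).2.
Qed.
End Rules.

(** * The program *)

(* Index arrays: 2 holds A, 3 holds K * A, 4 the item codes, 5 the subset counts;
   6 and 7 are the points i and j, 8 and 15 loop counters, 9 a running sum,
   10 and 11 the ends of a window, 12 and 13 the same before swapping, 14 holds l * A.
   Value arrays: 2 and 4 accumulate the two sums of phi, 3 and 5 binomials. *)
Definition inN : iexp := ILoad 0 (IConst 0).
Definition inK : iexp := ILoad 0 (IConst 1).
Definition inW : iexp := ILoad 0 (IConst 2).
Definition inM : iexp := ILoad 0 (IConst 3).
Definition inY : iexp := ILoad 0 (IConst 4).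

Definition same_label (r : iexp) : bexp :=
  BAnd (BILe (ILoad 1 r) inY) (BILe inY (ILoad 1 r)).

(** Indices cannot be multiplied: after [k] rounds registers 2 and 3 hold [2 k W] and [2 k^2 W],
    updated through [(k + 1)^2 = k^2 + 2 k + 1]. *)
Definition sizes_cmd : cmd :=
  For 6 inK
    (Seq (iset 3 (IAdd (reg 3) (IAdd (IAdd (reg 2) (reg 2)) (IAdd inW inW))))
         (iset 2 (IAdd (reg 2) (IAdd inW inW)))).

Definition codes_cmd : cmd :=
  For 7 inN
    (Seq (iset 9 (IConst 0))
    (Seq (For 8 inW
            (If (BVLe (VMul (VLoad 0 (reg 7)) (VOfIdx (ISub inW (IConst 1))))
                      (VOfIdx (reg 8)))
                Skip
                (iset 9 (IAdd (reg 9) (IConst 1)))))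
         (If (same_label (reg 7))
             (IStore 4 (reg 7) (IAdd (reg 2) (reg 9)))
             (IStore 4 (reg 7) (ISub (reg 2) (reg 9)))))).

(** Truncated subtraction makes the loop empty when the ends are in the wrong order. *)
Definition sum_cmd : cmd :=
  Seq (iset 9 (IConst 0))
      (For 8 (ISub (reg 11) (reg 10))
         (iset 9 (IAdd (reg 9) (ILoad 5 (IAdd (reg 10) (reg 8)))))).

Definition window_cmd : cmd :=
  Seq (If (same_label (reg 6))
          (Seq (iset 10 (reg 12)) (iset 11 (reg 13)))
          (Seq (iset 10 (reg 13)) (iset 11 (reg 12))))
      sum_cmd.

(** The table of the empty prefix: only the empty set, with code sum 0. *)
Definition clear_cmd : cmd :=
  Seq (For 8 (IAdd (reg 3) (IConst 1)) (IStore 5 (reg 8) (IConst 0)))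
      (iset 5 (IConst 1)).

Definition add_item_cmd : cmd :=
  For 8 (ISub (IAdd (reg 3) (IConst 1)) (ILoad 4 (reg 7)))
    (IStore 5 (ISub (reg 3) (reg 8))
       (IAdd (ILoad 5 (ISub (reg 3) (reg 8)))
             (ILoad 5 (ISub (ISub (reg 3) (reg 8)) (ILoad 4 (reg 7)))))).

(** The window is read before point [j] enters the table, which then counts subsets of the points
    before [j]. *)
Definition large_body : cmd :=
  Seq (If (BAnd (BILe (IAdd (reg 6) (IConst 1)) (reg 7)) (BILe inK (reg 7)))
          (Seq (iset 12 (ISub (reg 3) (ILoad 4 (reg 6))))
          (Seq (iset 13 (ISub (reg 3) (ILoad 4 (reg 7))))
          (Seq window_cmd
               (vset 2 (VAdd (vreg 2)
                  (VDiv (VOfIdx (reg 9))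
                        (VMul (VOfIdx (IAdd (reg 7) (IConst 1))) (vreg 3))))))))
          Skip)
 (Seq (If (BILe inK (reg 7))
          (vset 3 (VDiv (VMul (vreg 3) (VOfIdx (IAdd (reg 7) (IConst 1))))
                        (VOfIdx (ISub (IAdd (reg 7) (IConst 1)) inK))))
          Skip)
      (If (BAnd (BILe (reg 6) (reg 7)) (BILe (reg 7) (reg 6)))
          Skip
          add_item_cmd)).

Definition large_cmd : cmd :=
  Seq (vset 2 (VOfIdx (IConst 0)))
 (Seq (vset 3 (VOfIdx (IConst 1)))
      (For 7 inM large_body)).

Definition small_body : cmd :=
  Seq (iset 12 (ISub (IAdd (reg 14) (reg 2)) (ILoad 4 (reg 6))))
 (Seq (iset 13 (reg 14))
 (Seq window_cmd
 (Seq (vset 4 (VAdd (vreg 4) (VDiv (VOfIdx (reg 9)) (vreg 5))))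
 (Seq (vset 5 (VDiv (VMul (vreg 5)
                       (VOfIdx (ISub (ISub inN (IConst 1)) (reg 15))))
                    (VOfIdx (IAdd (reg 15) (IConst 1)))))
      (iset 14 (IAdd (reg 14) (reg 2))))))).

Definition small_cmd : cmd :=
  Seq (vset 4 (VOfIdx (IConst 0)))
 (Seq (vset 5 (VOfIdx (IConst 1)))
 (Seq (iset 14 (IConst 0))
      (For 15 inK small_body))).

Definition total_exp : vexp := VAdd (VDiv (vreg 4) (VOfIdx inN)) (vreg 2).

(** [large_cmd] leaves the table filled with the first [Mstar] points, which is the table
    [small_cmd] reads. *)
Definition point_cmd : cmd :=
  Seq clear_cmd
 (Seq large_cmd
 (Seq small_cmd
      (If (same_label (reg 6))
          (VStore 1 (reg 6) total_exp)
          (VStore 1 (reg 6) (VSub (VOfIdx (IConst 0)) total_exp))))).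

Definition knn_shapley : cmd :=
  Seq sizes_cmd (Seq codes_cmd (For 6 inN point_cmd)).

(** * Correctness and running time of the program *)

Section Correctness.
Variables (R : realType) (N K W M yv : nat) (lab : nat -> nat) (wt : nat -> R).
Variable e : nat -> nat.
Let A := (2 * K * W)%N.
Let L := (K * A)%N.
Hypotheses (W_gt0 : (0 < W)%N) (K_gt1 : (2 <= K)%N).
Hypotheses (M_gt0 : (0 < M)%N) (M_leN : (M <= N)%N).
Hypothesis e_bounds : forall j, (j < N)%N -> (A - W <= e j <= A + W)%N.
Hypothesis eE : forall j, (j < N)%N ->
  e j = item_code (lab j == yv) A (grid_index W (wt j)).

Implicit Types (st : store R) (c : nat -> nat).

Lemma W_leA : (4 * W <= A)%N.
Proof. by rewrite /A leq_mul2r; lia. Qed.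

Lemma A_leL : (2 * A <= L)%N.
Proof. by rewrite /L leq_mul2r; lia. Qed.

Definition has_input st : Prop :=
  [/\ imem st 0 =1 nth 0%N [:: N; K; W; M; yv], imem st 1 =1 lab
    & vmem st 0 =1 wt].

(** What preprocessing establishes and the main loop preserves. *)
Definition ready st : Prop :=
  [/\ has_input st, imem st 2 0 = A, imem st 3 0 = L
    & forall j, (j < N)%N -> imem st 4 j = e j].

Lemma has_input_frame cm st st' : frame cm st st' ->
  all (fun a => a \notin imods cm) [:: 0; 1]%N && (0%N \notin vmods cm) ->
  has_input st -> has_input st'.
Proof.
move=> [fi fv] /andP[/and3P[n0 n1 _] m0] [h0 h1 h2].
by split=> k; rewrite ?fi ?fv.
Qed.

Lemma ready_frame cm st st' : frame cm st st' ->
  all (fun a => a \notin imods cm) [:: 0; 1; 2; 3; 4]%N && (0%N \notin vmods cm) ->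
  ready st -> ready st'.
Proof.
move=> fr /andP[/= /and5P[n0 n1 n2 n3 /andP[n4 _]] m0] [hi h2 h3 h4].
split; rewrite ?fr.1 //; first by apply: has_input_frame fr _ hi; rewrite /= n0 n1 m0.
by move=> j jN; rewrite fr.1 // h4.
Qed.

Lemma ready_iupd im vm a k v : (4 < a)%N -> ready (Store im vm) ->
  ready (Store (upd im a k v) vm).
Proof.
by case: a => [|[|[|[|[|a]]]]] // _ [[h0 h1 h2] h3 h4 h5]; split=> //; split.
Qed.

Lemma ready_vupd im vm a k v : (0 < a)%N -> ready (Store im vm) ->
  ready (Store im (upd vm a k v)).
Proof. by case: a => [|a] // _ [[h0 h1 h2] h3 h4 h5]; split=> //; split. Qed.

Lemma same_labelE st r : has_input st ->
  beval st (same_label r) = (lab (ieval st r) == yv).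
Proof. by move=> [h0 h1 _] /=; rewrite h0 h1 /= eqn_leq. Qed.

Lemma run_sum st lo hi : imem st 10 0 = lo -> imem st 11 0 = hi ->
  run (hi - lo).+1 sum_cmd st
    (fun st' => imem st' 9 0 = (\sum_(lo <= x < hi) imem st 5 x)%N).
Proof.
move=> lo_ hi_; apply: run_seq; apply: run_istore => //=.
apply: (@run_for _ (fun k st' => imem st' 9 0 =
    (\sum_(lo <= x < lo + k) imem st 5 x)%N) 1 _ (hi - lo)%N); rewrite ?muln1 //.
- by move=> st' [fi _] /=; rewrite !fi //= /upd /= lo_ hi_.
- by rewrite /= /upd /= addn0 big_geq.
- move=> k st' kn [fi _] r8 IH; apply: run_istore => //=.
  rewrite /upd /= IH r8 !fi //= /upd /= lo_ addnS big_nat_recr //= leq_addr //.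
move=> st' _ ->; case: (leqP lo hi) => lh; first by rewrite subnKC.
by rewrite !big_geq //; lia.
Qed.

(** Both differences are bounded because the label may swap the ends. *)
Lemma run_window st i p q B : ready st -> imem st 6 0 = i ->
  imem st 12 0 = p -> imem st 13 0 = q -> (p - q <= B)%N -> (q - p <= B)%N ->
  run B.+1 window_cmd st
    (fun st' => imem st' 9 0 = window_sum (lab i == yv) (imem st 5) p q).
Proof.
move=> rd i_ p_ q_ pB qB; apply: run_seq; apply: run_if => //.
rewrite same_labelE /=; last by case: rd.
rewrite i_ /window_sum; case: (lab i == yv);
  (apply: run_seq; apply: run_istore => //; apply: run_istore => //);
  by apply: (run_call (run_sum _ _)) => //=; rewrite /upd /= ?p_ ?q_.
Qed.

Lemma run_clear st : ready st ->
  run L.+2 clear_cmd st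
    (fun st' => forall x, (x <= L)%N -> imem st' 5 x = (x == 0)%N).
Proof.
move=> [_ _ r3 _]; apply: run_seq.
apply: (@run_for _ (fun k st' => forall x, (x < k)%N -> imem st' 5 x = 0%N)
    1 _ L.+1); rewrite ?muln1 //.
- by move=> st' [fi _] /=; rewrite fi // r3 addn1.
- move=> k st' kn _ r8 IH; apply: run_istore => //= x.
  by rewrite /upd /= r8 ltnS leq_eqVlt; case: eqP => //= _ /IH.
move=> st' _ IH; apply: run_istore => //= x xL; rewrite /upd /=.
by case: eqP => //= _; rewrite IH.
Qed.

(** One pass over the [O(K^2 W)] cells; after [k] steps exactly the cells above [L - k] have
    received their update. *)
Lemma run_add_item st j c : ready st -> (j < N)%N -> imem st 7 0 = j ->
  (forall x, (x <= L)%N -> imem st 5 x = c x) ->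
  run L.+2 add_item_cmd st (fun st' => forall x, (x <= L)%N ->
    imem st' 5 x = (c x + if e j <= x then c (x - e j) else 0)%N).
Proof.
move=> [_ _ r3 r4] jN j_ c_; have ej := e_bounds jN.
have [WA AL] := (W_leA, A_leL).
(* Descending order: the cells still to be read are not yet overwritten. *)
apply: (@run_for _ (fun k st' => forall x, (x <= L)%N -> imem st' 5 x =
    (c x + if (L < x + k) && (e j <= x) then c (x - e j) else 0)%N)
    1 _ (L.+1 - e j)%N); rewrite ?muln1 //.
- by rewrite ltnS leq_subr.
- by move=> st' [fi _] /=; rewrite !fi // j_ r3 r4 // addn1.
- move=> x xL /=; rewrite /upd /= c_ // addn0 ltnNge xL /= addn0 //.
- move=> k st' kn [fi _] r8 IH; apply: run_istore => //= x xL.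
  rewrite /upd /= r8 (fi 7) // (fi 3) // (fi 4) // j_ r3 r4 //.
  case: eqP => [->|xk].
    (* Both cells read, [L - k] and [L - k - e j], still hold their old counts. *)
    rewrite !IH; try lia.
    have -> : (L < L - k + k)%N = false by lia.
    have -> : (L < L - k - e j + k)%N = false by lia.
    have -> : (L < L - k + k.+1)%N by lia.
    have -> : (e j <= L - k)%N by lia.
    by rewrite /= !addn0.
  rewrite IH //; congr (_ + if _ && _ then _ else _)%N; lia.
move=> st' _ IH x xL; rewrite IH //.
(* After [L + 1 - e j] steps every cell [x] with [e j <= x] has been visited. *)
by case: (leqP (e j) x) => ex; rewrite ?andbF ?andbT //; case: ifP => //; lia.
Qed.

(** The stored table agrees with the true counts only up to [L], which covers every window. *)
Lemma eq_window_sum (same : bool) c c' p q B :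
  (forall x, (x <= B)%N -> c x = c' x) -> (p <= B)%N -> (q <= B)%N ->
  window_sum same c p q = window_sum same c' p q.
Proof.
move=> cc pB qB; rewrite /window_sum.
by case: same; apply: eq_big_nat => x xpq; apply: cc; lia.
Qed.

(** * The two sums for one point *)

Definition large_term i j : R :=
  (window_sum (lab i == yv) (subset_count e i j) (L - e i) (L - e j))%:R
    / (j.+1 * 'C(j, K))%:R.

(** The binomial ['C(maxn j K, K)] stays 1 until [j] reaches [K]; from then on the update divides by
    the nonzero [j + 1 - K]. *)
Lemma run_large_body st i j acc : ready st -> (i < N)%N -> (j < N)%N ->
  imem st 6 0 = i -> imem st 7 0 = j ->
  (forall x, (x <= L)%N -> imem st 5 x = subset_count e i j x) ->
  vmem st 2 0 = acc -> vmem st 3 0 = 'C(maxn j K, K)%:R ->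
  run L.+2 large_body st (fun st' =>
    [/\ forall x, (x <= L)%N -> imem st' 5 x = subset_count e i j.+1 x,
        vmem st' 2 0 = acc + (if (i < j)%N && (K <= j)%N then large_term i j else 0)
      & vmem st' 3 0 = 'C(maxn j.+1 K, K)%:R]).
Proof.
move=> rd iN jN i_ j_ c_ acc_ bin_; have [[in_ _ _] _ r3 r4] := rd.
have [ei ej] := (e_bounds iN, e_bounds jN).
have [WA AL] := (W_leA, A_leL).
apply: run_seq; apply: (@run_call _ _ L.+2 _ _ (fun st' => vmem st' 2 0 =
    acc + (if (i < j)%N && (K <= j)%N then large_term i j else 0))) => //.
  apply: run_if => //=; rewrite i_ j_ in_ /= addn1.
  case: ifP => [/andP[ij Kj]|_]; last by apply: run_skip; rewrite // addr0.
  apply: run_seq; apply: run_istore => //=.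
  apply: run_seq; apply: run_istore => //=.
  apply: run_seq; set st2 := Store _ _.
  have rd2 : ready st2 by do 2!apply: ready_iupd => //.
  (* Both codes are within [W] of [A], hence at most [2 W] apart. *)
  apply: (run_call (@run_window st2 i (L - e i) (L - e j) (2 * W) rd2 _ _ _ _ _));
    rewrite /= ?/upd /= ?i_ ?j_ ?r3 ?r4 //; try lia.
  move=> st3 [fi fv] w_; apply: run_vstore => //=.
  rewrite /upd /= w_ !fv // !fi //= /upd /= acc_ bin_ j_ addn1.
  rewrite (maxn_idPl Kj) /large_term natrM.
  by rewrite (@eq_window_sum _ _ (subset_count e i j) _ _ L) // leq_subr.
move=> st1 fr1 acc1; apply: run_seq.
have rd1 : ready st1 by exact: ready_frame fr1 _ rd.
have [[in1 _ _] _ _ _] := rd1.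
apply: (@run_call _ _ L.+2 _ _ (fun st' =>
    vmem st' 3 0 = 'C(maxn j.+1 K, K)%:R)) => //.
  apply: run_if => //=; rewrite in1 fr1.1 // j_ /=.
  case: leqP => jK; last first.
    by apply: run_skip => //; rewrite fr1.2 // bin_ !(maxn_idPr _) // ltnW.
  apply: run_vstore => //=; rewrite /upd /= fr1.2 // fr1.1 // in1 /= j_ bin_ addn1.
  rewrite (maxn_idPl jK) (maxn_idPl (leqW jK)).
  (* Uses [(j + 1) 'C(j, K) = (j + 1 - K) 'C(j + 1, K)]. *)
  have := mul_bin_down j.+1 K; rewrite /= => /(congr1 (fun n => n%:R : R)).
  rewrite !natrM mulrC => ->; rewrite mulrAC mulfV ?mul1r //.
  by rewrite pnatr_eq0 -lt0n subn_gt0 ltnS.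
move=> st2 fr2 bin2.
have rd2 : ready st2 by exact: ready_frame fr2 _ rd1.
have i2 : imem st2 6 0 = i by rewrite fr2.1 // fr1.1.
have j2 : imem st2 7 0 = j by rewrite fr2.1 // fr1.1.
have c2 x : (x <= L)%N -> imem st2 5 x = subset_count e i j x.
  by move=> xL; rewrite fr2.1 // fr1.1 // c_.
apply: run_if => //=; rewrite i2 j2 -eqn_leq.
case: eqP => [ij|/eqP ij].
  apply: run_skip => //; rewrite fr2.2 //; split=> // x xL.
  by rewrite c2 // ij eqxx addn0.
apply: (run_call (run_add_item rd2 jN j2 c2)) => // st3 fr3 c3.
rewrite !fr3.2 // fr2.2 //; split=> // x xL.
by rewrite c3 // eq_sym ij.
Qed.

Lemma run_large st i : ready st -> (i < N)%N -> imem st 6 0 = i ->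
  (forall x, (x <= L)%N -> imem st 5 x = (x == 0)%N) ->
  run (M.+1 * L.+2) large_cmd st (fun st' =>
    (forall x, (x <= L)%N -> imem st' 5 x = subset_count e i M x) /\
    vmem st' 2 0 =
      \sum_(0 <= j < M | (i < j)%N && (K <= j)%N) large_term i j).
Proof.
move=> rd iN i_ c_.
apply: run_seq; apply: run_vstore => //=.
apply: run_seq; apply: run_vstore => //=.
set st0 := Store _ _.
have rd0 : ready st0 by do 2!apply: ready_vupd => //.
apply: (@run_for _ (fun k st' =>
  [/\ forall x, (x <= L)%N -> imem st' 5 x = subset_count e i k x,
      vmem st' 2 0 = \sum_(0 <= j < k | (i < j)%N && (K <= j)%N) large_term i j
    & vmem st' 3 0 = 'C(maxn k K, K)%:R]) L.+2 _ M) => //.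
- by move=> st' fr; have [[in_ _ _] _ _ _] := ready_frame fr isT rd0; rewrite /= in_.
- by rewrite /= /upd /=; split=> //; rewrite ?big_geq ?max0n ?binn.
- move=> k st' kM fr k_ [c1 acc1 bin1].
  have rd1 := ready_frame fr isT rd0.
  have i1 : imem st' 6 0 = i by rewrite fr.1.
  apply: (run_call (run_large_body rd1 iN _ i1 k_ c1 acc1 bin1)) => //.
    exact: leq_trans kM _.
  move=> st2 _ [c2 acc2 bin2]; split; rewrite /= /upd /= ?acc2 ?bin2 //.
  by rewrite big_mkcond /= [in RHS]big_mkcond /= big_nat_recr.
by move=> st' _ [].
Qed.

Definition small_term i l : R :=
  (window_sum (lab i == yv) (subset_count e i M) (l.+1 * A - e i) (l * A))%:R
    / 'C(N - 1, l)%:R.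

(** There are [K] windows of length at most [2 W], so no table update is involved and the time is
    [O(K W)]. *)
Lemma run_small st i : ready st -> (i < N)%N -> imem st 6 0 = i ->
  (forall x, (x <= L)%N -> imem st 5 x = subset_count e i M x) ->
  run (K.+1 * (2 * W).+1) small_cmd st (fun st' =>
    vmem st' 4 0 = \sum_(0 <= l < K) small_term i l).
Proof.
move=> rd iN i_ c_; have ei := e_bounds iN.
have [WA AL] := (W_leA, A_leL).
apply: run_seq; apply: run_vstore => //=.
apply: run_seq; apply: run_vstore => //=.
apply: run_seq; apply: run_istore => //=.
set st0 := Store _ _.
have rd0 : ready st0 by apply: ready_iupd => //; do 2!apply: ready_vupd => //.
apply: (@run_for _ (fun k st' =>
  [/\ imem st' 14 0 = (k * A)%N,
      vmem st' 4 0 = \sum_(0 <= l < k) small_term i l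
    & vmem st' 5 0 = 'C(N - 1, k)%:R]) (2 * W).+1 _ K) => //.
- by move=> st' fr; have [[in_ _ _] _ _ _] := ready_frame fr isT rd0; rewrite /= in_.
- by rewrite /= /upd /=; split=> //; rewrite ?big_geq ?bin0.
- move=> l st' lK fr l_ [lA1 g1 bin1].
  have rd1 := ready_frame fr isT rd0.
  have i1 : imem st' 6 0 = i by rewrite fr.1.
  have [[in1 _ _] r2 _ r4] := rd1.
  have lAL : (l.+1 * A <= L)%N by rewrite /L leq_mul2r lK orbT.
  have lAS : (l.+1 * A = l * A + A)%N by rewrite mulSn addnC.
  apply: run_seq; apply: run_istore => //=.
  apply: run_seq; apply: run_istore => //=.
  apply: run_seq; set st2 := Store _ _.
  have rd2 : ready st2 by do 2!apply: ready_iupd => //.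
  apply: (run_call (@run_window st2 i (l.+1 * A - e i) (l * A) (2 * W) rd2 _ _ _ _ _));
    rewrite /= ?/upd /= ?i1 ?lA1 ?r2 ?r4 ?lAS //; try lia.
  move=> st3 fr3 w_.
  have rd3 := ready_frame fr3 isT rd2.
  have [[in3 _ _] r23 _ _] := rd3.
  apply: run_seq; apply: run_vstore => //=.
  apply: run_seq; apply: run_vstore => //=.
  apply: run_istore => //=; rewrite /upd /=.
  rewrite w_ in3 r23 !fr3.1 // !fr3.2 //= /upd /= lA1 g1 bin1 l_ addn1.
  split=> //.
    rewrite big_nat_recr //= /small_term lAS.
    rewrite (@eq_window_sum _ _ (subset_count e i M) _ _ L) //; try lia.
    by move=> x xL; rewrite fr.1 //; exact: c_.
  (* Uses [(l + 1) 'C(N - 1, l + 1) = (N - 1 - l) 'C(N - 1, l)]. *)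
  have := mul_bin_left (N - 1) l => /(congr1 (fun n => n%:R : R)).
  rewrite !natrM [X in _ = X]mulrC => <-; rewrite mulrAC mulfV ?mul1r //.
  by rewrite pnatr_eq0.
by move=> st' _ [].
Qed.

Lemma run_point st i : ready st -> (i < N)%N -> imem st 6 0 = i ->
  run (M.+1 * L.+2) point_cmd st (fun st' => forall i', vmem st' 1 i' =
    if i' == i then (2 * (lab i == yv)%:R - 1) * phi_dp R N K M A e (lab i == yv) i
    else vmem st 1 i').
Proof.
move=> rd iN i_.
apply: run_seq; apply: (run_call (run_clear rd)); first by rewrite leq_pmull.
move=> st1 fr1 c1; have rd1 := ready_frame fr1 isT rd.
have i1 : imem st1 6 0 = i by rewrite fr1.1.
apply: run_seq; apply: (run_call (run_large rd1 iN i1 c1)) => //.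
move=> st2 fr2 [c2 acc2]; have rd2 := ready_frame fr2 isT rd1.
have i2 : imem st2 6 0 = i by rewrite fr2.1.
apply: run_seq; apply: (run_call (run_small rd2 iN i2 c2)).
  (* As [M >= 1] and [L = 2 K^2 W], it is enough to bound [(K + 1)(2 W + 1)] by
     [2 (2 K^2 W + 2)]. *)
  have : (2 * (K * K * W).*2.+2 <= M.+1 * L.+2)%N.
    by apply: leq_mul; rewrite // /L /A; nia.
  have : (2 * (K * W) <= K * K * W)%N by rewrite -mulnA leq_mul2r K_gt1 orbT.
  have : (2 * W <= K * W)%N by rewrite leq_mul2r K_gt1 orbT.
  have : (K <= K * W)%N by rewrite leq_pmulr.
  lia.
move=> st3 fr3 g3; have rd3 := ready_frame fr3 isT rd2.
have i3 : imem st3 6 0 = i by rewrite fr3.1.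
have [[in3 _ _] _ _ _] := rd3.
have out3 i' : vmem st3 1 i' = vmem st 1 i' by rewrite fr3.2 // fr2.2 // fr1.2.
have phiE : vmem st3 4 0 / N%:R + vmem st3 2 0 = phi_dp R N K M A e (lab i == yv) i.
  by rewrite g3 fr3.2 // acc2 /phi_dp mulrC.
apply: run_if => //; rewrite same_labelE /=; last by case: rd3.
rewrite i3; case: (lab i == yv) phiE => phiE;
  apply: run_vstore => //= i';
  rewrite /upd /= i3 in3 /= phiE; case: ifP => // _.
  by rewrite mulr1 -addrA subrr addr0 mul1r.
by rewrite mulr0 !sub0r mulN1r.
Qed.

(** * Preprocessing and the whole program *)

Lemma run_sizes st : has_input st -> imem st 2 0 = 0%N -> imem st 3 0 = 0%N ->
  run K.+1 sizes_cmd st (fun st' => imem st' 2 0 = A /\ imem st' 3 0 = L).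
Proof.
move=> hin a0 l0.
apply: (@run_for _ (fun k st' => imem st' 2 0 = (2 * k * W)%N /\
    imem st' 3 0 = (k * (2 * k * W))%N) 1 _ K); rewrite ?muln1 //.
- by move=> st' fr; have [in_ _ _] := has_input_frame fr isT hin; rewrite /= in_.
- move=> k st' _ fr k_ [a1 l1]; have [in_ _ _] := has_input_frame fr isT hin.
  apply: run_seq; apply: run_istore => //=; apply: run_istore => //=.
  rewrite /upd /= in_ a1 l1 /=; nia.
Qed.

Lemma run_codes st : has_input st -> imem st 2 0 = A ->
  run (N.+1 * W.+1) codes_cmd st (fun st' =>
    forall j, (j < N)%N -> imem st' 4 j = e j).
Proof.
move=> hin a0.
apply: (@run_for _ (fun k st' => forall j, (j < k)%N -> imem st' 4 j = e j)
   W.+1 _ N) => //.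
- by move=> st' fr; have [in_ _ _] := has_input_frame fr isT hin; rewrite /= in_.
move=> j st' jN fr j_ IH.
have hin1 := has_input_frame fr isT hin.
apply: run_seq; apply: run_istore => //=; set st0 := Store _ _.
have hin0 : has_input st0 by case: hin1.
apply: run_seq; apply: (@run_for _ (fun k st1 => imem st1 9 0 =
  (\sum_(0 <= r < k) ~~ (wt j * (W - 1)%:R <= r%:R)%R)%N) 1 _ W); rewrite ?muln1 //.
- by move=> st1 fr1; have [in_ _ _] := has_input_frame fr1 isT hin0; rewrite /= in_.
- by rewrite big_geq.
- move=> k st1 kW fr1 k_ IH1; have [in_ _ wt_] := has_input_frame fr1 isT hin0.
  apply: run_if => //=; rewrite in_ fr1.1 //= wt_ k_ /upd /= j_ /=.
  case: ifP => kw; [apply: run_skip => //|apply: run_istore => //=];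
    by rewrite /= /upd /= IH1 big_nat_recr //= kw ?addn0.
move=> st1 fr1 IH1; have hin2 := has_input_frame fr1 isT hin0.
have j1 : imem st1 7 0 = j by rewrite fr1.1.
have a1 : imem st1 2 0 = A by rewrite fr1.1 //= /upd /= fr.1.
have IH2 j' : (j' < j)%N -> imem st1 4 j' = e j'.
  by move=> j'j; rewrite fr1.1 //= /upd /= IH.
apply: run_if => //; rewrite same_labelE //= j1.
by case: ifP => lj; apply: run_istore => //= j'; rewrite /upd /= j1 a1 IH1 ltnS leq_eqVlt;
  case: eqP => [-> _|_ /IH2] //=; rewrite eE // /item_code lj.
Qed.

(** Preprocessing takes [O(K + N W)], below the [N] rounds of [O(M K^2 W)] for the points. *)
Lemma run_knn_shapley st :
  (K <= N)%N -> has_input st -> imem st 2 0 = 0%N -> imem st 3 0 = 0%N ->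
  run (N.+1 * (M.+1 * L.+2)) knn_shapley st (fun st' => forall i, (i < N)%N ->
    vmem st' 1 i =
    (2 * (lab i == yv)%:R - 1) * phi_dp R N K M A e (lab i == yv) i).
Proof.
move=> KN hin a0 l0; have [WA AL] := (W_leA, A_leL).
have AE : A = (K * W).*2 by rewrite /A; lia.
have ML : (L.+2 <= M.+1 * L.+2)%N by rewrite leq_pmull.
have WKW : (W <= K * W)%N by rewrite leq_pmull; lia.
apply: run_seq; apply: (run_call (run_sizes hin a0 l0)).
  by rewrite -[K.+1]muln1 leq_mul.
move=> st1 fr1 [a1 l1]; have hin1 := has_input_frame fr1 isT hin.
apply: run_seq; apply: (run_call (run_codes hin1 a1)).
  by rewrite leq_mul //; lia.
move=> st2 fr2 e2; have hin2 := has_input_frame fr2 isT hin1.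
have rd2 : ready st2 by split=> //; rewrite fr2.1.
apply: (@run_for _ (fun k st' => forall i, (i < k)%N -> vmem st' 1 i =
    (2 * (lab i == yv)%:R - 1) * phi_dp R N K M A e (lab i == yv) i)
  (M.+1 * L.+2) _ N) => //.
- by move=> st' fr; have [[in_ _ _] _ _ _] := ready_frame fr isT rd2; rewrite /= in_.
- move=> i st' iN fr i_ IH; have rd' := ready_frame fr isT rd2.
  apply: (run_call (run_point rd' iN i_)) => // st3 _ phi3 i' /=.
  by rewrite phi3 ltnS leq_eqVlt; case: eqP => [->|_ /IH].
Qed.

End Correctness.

Local Open Scope classical_set_scope.

Theorem theorem7 :
  exists (P : cmd) (C : nat),
  forall (R : realType) (X : Type) (d : X -> X -> R) (N K b Mstar : nat)
    (x : 'I_N -> X) (y : 'I_N -> bool) (xval : X) (yval : bool)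
    (w : 'I_N -> R),
  (2 <= K)%N -> (K <= N)%N -> (1 <= Mstar <= N)%N ->
  (forall j : 'I_N, weight_grid b (w j)) ->
  (forall j k : 'I_N, (j <= k)%N -> d (x j) xval <= d (x k) xval) ->
  exists (t : nat) (st : store R),
    [/\ exec P (input_store K (2 ^ b) Mstar y yval w) t st,
        (t <= C * (2 ^ b * K ^ 2 * N * Mstar))%N
      & forall i : 'I_N, output st i = phi_hat K Mstar y yval w i].
Proof.
(* The factor 12 is [2 * 2 * 3], from [N + 1 <= 2 N], [M + 1 <= 2 M] and
   [2 K^2 W + 2 <= 3 K^2 W]. *)
exists knn_shapley, (csize knn_shapley * 12)%N.
move=> R X d N K b M x y xval yval w K2 KN /andP[M1 MN] wW _.
set W := (2 ^ b)%N; have W0 : (0 < W)%N by rewrite expn_gt0.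
(* Labels and weights as the machine sees them: total functions on cells, with 0 beyond the data. *)
pose lab := nth 0%N [seq nat_of_bool (y j) | j <- enum 'I_N].
pose wt := nth 0 [seq w j | j <- enum 'I_N].
pose e j := item_code (lab j == yval) (2 * K * W) (grid_index W (wt j)).
have labE (j : 'I_N) : (lab j == yval) = (y j == yval).
  rewrite /lab (nth_map j) ?size_enum_ord // nth_ord_enum.
  by case: (y j); case: (yval).
have wtE (j : 'I_N) : wt j = w j.
  by rewrite /wt (nth_map j) ?size_enum_ord // nth_ord_enum.
have eE (j : 'I_N) : e j = item_code (y j == yval) (2 * K * W) (grid_index W (w j)).
  by rewrite /e labE wtE.
have eb j : (j < N)%N -> (2 * K * W - W <= e j <= 2 * K * W + W)%N.
  move=> jN; have [delta _ /(_ _ (wW (Ordinal jN)))[kW _]] := grid_step R b.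
  by rewrite (eE (Ordinal jN)) /item_code; case: ifP => _; move: kW; rewrite -/W; lia.
have [|//|//|t [st [ex tle out]]] := @run_knn_shapley R N K W M yval lab wt e
  W0 K2 M1 MN eb (fun _ _ => erefl) (input_store K W M y yval w) KN.
  by split=> //; move=> k /=; rewrite ?nth_nil.
exists t, st; split=> //; last first.
  by move=> i; rewrite /output out // labE (phi_hatE _ K2 MN wW eE).
move: tle; move: (csize knn_shapley) => c tle.
apply: (leq_trans tle); rewrite -[leqRHS]mulnA leq_mul2l; apply/orP; right.
have W2 : (4 <= W * K ^ 2)%N.
  by rewrite (leq_trans (_ : 4 <= K ^ 2)%N) ?leq_pmull // (@leq_exp2r 2 K 2).
have le1 : ((K * (2 * K * W)).+2 <= 3 * (W * K ^ 2))%N by rewrite expnS expn1; lia.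
have le2 : (N.+1 <= 2 * N)%N by lia.
have le3 : (M.+1 <= 2 * M)%N by lia.
apply: leq_trans (leq_mul le2 (leq_mul le3 le1)) _.
by rewrite leq_eqVlt; apply/orP; left; apply/eqP; ring.
Qed.
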